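(* Let $k\le n-1$. Fix $u_1,\dots,u_k\in\mathbb{R}^n$ and $v_1,\dots,v_k\in\mathbb{R}^n$. For $i=1,\dots,m$, let $B_i=\sum_{j=1}^k\beta_{ij}u_jv_j^\intercal$ for some $\beta_{ij}\in\mathbb{R}$. Let $\mathcal{B}:\mathbb{R}^{n\times n}\to\mathbb{R}^m$ be $\mathcal{B}(X)=(\langle B_i,X\rangle)_{i\in[m]}$. Then $\mathcal{B}(\mathrm{SO}(n))$ is convex.
   Context: $\mathrm{SO}(n)=\{X\in\mathbb{R}^{n\times n}: X^\intercal X=I,\ \det(X)=1\}$; $\langle B,X\rangle=\operatorname{tr}(B^\intercal X)$; $[m]=\{1,\dots,m\}$. *)

(* Defs.v *)
From HB Require Import structures.
From mathcomp Require Import all_boot all_order all_algebra.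
From mathcomp Require Import boolp classical_sets reals convex.

Set Implicit Arguments.
Unset Strict Implicit.
Unset Printing Implicit Defensive.

Import Order.TTheory GRing.Theory Num.Theory.
Local Open Scope classical_set_scope.
Local Open Scope ring_scope.

Definition SO (R : realType) (n : nat) : set 'M[R]_n :=
  [set X | X^T *m X = 1%:M /\ \det X = 1].

Definition mxinner (R : realType) (n : nat) (B X : 'M[R]_n) : R :=
  \tr (B^T *m X).

Definition mxinner_map (R : realType) (n m : nat) (B : 'I_m -> 'M[R]_n)
    (X : 'M[R]_n) : 'rV[R]_m :=
  \row_(i < m) mxinner (B i) X.

(* Main.v *)
Require Import Defs.
From HB Require Import structures.
From mathcomp Require Import all_boot all_order all_algebra.
From mathcomp Require Import ring lra.
From mathcomp Require Import boolp classical_sets reals interval_inference.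
From mathcomp Require Import convex topology normedtype derive.

Import Order.TTheory GRing.Theory Num.Theory.
Import numFieldNormedType.Exports.
Local Open Scope classical_set_scope.
Local Open Scope ring_scope.

Set Implicit Arguments.
Unset Strict Implicit.
Unset Printing Implicit Defensive.

(** Let U, V be square matrices whose first k columns are the u_j, v_j. Since
    <u_j v_j^T, X> = (U^T X V)_jj, it suffices to find, for every contraction M
    (for instance a convex combination of two rotations), a rotation X such that
    U^T X V and U^T M V have the same diagonal entries except possibly the last.

    If U and V are invertible, maximize <U T V^T, X> - w |r(X)|^2 over the
    contractions X, where r(X) lists these n - 1 diagonal entries of
    U^T (X - M) V and T has ones above the diagonal and a constant c in the
    lower left corner. The maximizer X also maximizes <Y, .> for the gradient
    Y = U (T + D) V^T, with D diagonal and D_nn = 0; hence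
    det Y = (-1)^(n-1) c det U det V whatever D is, and c can be chosen to make
    it positive. A maximizer of <Y, .> over the contractions with det Y > 0 is a
    rotation, the orthogonal polar factor of Y. As w grows, r(X) tends to 0.
    Invertibility and exactness follow by compactness of SO(n). *)

(** * Frobenius inner product and norm *)

Definition frob (R : realType) (m n : nat) (A B : 'M[R]_(m, n)) : R :=
  \tr (A^T *m B).

Definition sqn (R : realType) (m n : nat) (A : 'M[R]_(m, n)) : R := frob A A.

(** The closed unit ball of the spectral norm, a compact convex set that contains the rotations.
    Each fixed vector contributes one closed condition on the matrix. *)
Definition contractive (R : realType) (n : nat) : set 'M[R]_n :=
  [set X | forall x : 'cV_n, sqn (X *m x) <= sqn x].

Section Frobenius.
Variable R : realType.

Lemma frobE m n (A B : 'M[R]_(m, n)) : frob A B = \sum_i \sum_j A i j * B i j.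
Proof.
rewrite /frob /mxtrace exchange_big; apply: eq_bigr => j _.
by rewrite mxE; apply: eq_bigr => i _; rewrite mxE.
Qed.

Lemma frobC m n (A B : 'M[R]_(m, n)) : frob A B = frob B A.
Proof. by rewrite /frob -mxtrace_tr trmx_mul trmxK. Qed.

Lemma frobDl m n (A B C : 'M[R]_(m, n)) : frob (A + B) C = frob A C + frob B C.
Proof. by rewrite /frob [(A + B)^T]linearD mulmxDl mxtraceD. Qed.

Lemma frobZl m n a (A B : 'M[R]_(m, n)) : frob (a *: A) B = a * frob A B.
Proof. by rewrite /frob linearZ /= -scalemxAl mxtraceZ. Qed.

Lemma frobDr m n (A B C : 'M[R]_(m, n)) : frob A (B + C) = frob A B + frob A C.
Proof. by rewrite /frob mulmxDr linearD. Qed.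

Lemma frobZr m n a (A B : 'M[R]_(m, n)) : frob A (a *: B) = a * frob A B.
Proof. by rewrite /frob -scalemxAr mxtraceZ. Qed.

Lemma frobNr m n (A B : 'M[R]_(m, n)) : frob A (- B) = - frob A B.
Proof. by rewrite /frob mulmxN linearN. Qed.

Lemma frobBr m n (A B C : 'M[R]_(m, n)) : frob A (B - C) = frob A B - frob A C.
Proof. by rewrite frobDr frobNr. Qed.

Lemma frob_suml (I : Type) (r : seq I) m n
    (F : I -> 'M[R]_(m, n)) (B : 'M[R]_(m, n)) :
  frob (\sum_(i <- r) F i) B = \sum_(i <- r) frob (F i) B.
Proof.
elim/big_rec2: _ => [|i a A _ <-]; last by rewrite frobDl.
by rewrite /frob trmx0 mul0mx mxtrace0.
Qed.

Lemma frob_mull m n p (A : 'M[R]_(m, n)) (B : 'M_(n, p)) C :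
  frob (A *m B) C = frob B (A^T *m C).
Proof. by rewrite /frob trmx_mul mulmxA. Qed.

Lemma frob_mulr m n p (A : 'M[R]_(m, n)) (B : 'M_(n, p)) C :
  frob (A *m B) C = frob A (C *m B^T).
Proof. by rewrite /frob trmx_mul -mulmxA mxtrace_mulC mulmxA. Qed.

Lemma frob_tr m n (A B : 'M[R]_(m, n)) : frob A^T B^T = frob A B.
Proof. by rewrite /frob trmxK -mxtrace_tr trmx_mul trmxK mxtrace_mulC. Qed.

Lemma sqnE m n (A : 'M[R]_(m, n)) : sqn A = \sum_i \sum_j A i j ^+ 2.
Proof. by rewrite /sqn frobE; do 2!apply: eq_bigr => ? _; rewrite expr2. Qed.

Lemma sqn_ge0 m n (A : 'M[R]_(m, n)) : 0 <= sqn A.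
Proof. by rewrite sqnE; do 2!apply: sumr_ge0 => ? _; rewrite sqr_ge0. Qed.

Lemma sqn0 m n : sqn (0 : 'M[R]_(m, n)) = 0.
Proof. by rewrite /sqn /frob mulmx0 mxtrace0. Qed.

Lemma sqn_eq0 m n (A : 'M[R]_(m, n)) : sqn A = 0 -> A = 0.
Proof.
rewrite sqnE => /psumr_eq0P rows0; apply/matrixP => i j; rewrite mxE.
have /psumr_eq0P : \sum_j A i j ^+ 2 = 0.
  by apply: rows0 => // k _; apply: sumr_ge0 => l _; rewrite sqr_ge0.
by move=> /(_ (fun _ _ => sqr_ge0 _) j isT)/eqP; rewrite sqrf_eq0 => /eqP.
Qed.

Lemma sqn_gt0 m n (A : 'M[R]_(m, n)) : A != 0 -> 0 < sqn A.
Proof.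
move=> A0; rewrite lt_neqAle sqn_ge0 andbT eq_sym.
by apply: contra_neq A0; apply: sqn_eq0.
Qed.

Lemma sqnD m n (A B : 'M[R]_(m, n)) :
  sqn (A + B) = sqn A + 2 * frob A B + sqn B.
Proof. by rewrite /sqn frobDl !frobDr (frobC B A); ring. Qed.

Lemma sqnZ m n a (A : 'M[R]_(m, n)) : sqn (a *: A) = a ^+ 2 * sqn A.
Proof. by rewrite /sqn frobZl frobZr; ring. Qed.

Lemma sqnN m n (A : 'M[R]_(m, n)) : sqn (- A) = sqn A.
Proof. by rewrite -scaleN1r sqnZ sqrrN expr1n mul1r. Qed.

Lemma frob_le_sqn m n (A B : 'M[R]_(m, n)) : 2 * frob A B <= sqn A + sqn B.
Proof. by have := sqn_ge0 (A - B); rewrite sqnD sqnN frobNr; lra. Qed.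

Lemma frob_CauchySchwarz m n (A B : 'M[R]_(m, n)) :
  frob A B ^+ 2 <= sqn A * sqn B.
Proof.
have [->|B0] := eqVneq B 0.
  by rewrite sqn0 mulr0 /frob mulmx0 mxtrace0 expr0n.
have := sqn_ge0 (sqn B *: A - frob A B *: B).
rewrite sqnD sqnN frobNr !sqnZ frobZl frobZr.
have -> : sqn B ^+ 2 * sqn A + 2 * - (sqn B * (frob A B * frob A B)) +
  frob A B ^+ 2 * sqn B = sqn B * (sqn A * sqn B - frob A B ^+ 2) by ring.
by rewrite pmulr_rge0 ?sqn_gt0// subr_ge0.
Qed.

(** Cauchy-Schwarz applied to each row. *)
Lemma sqn_mul_le m n (A : 'M[R]_(m, n)) (x : 'cV_n) :
  sqn (A *m x) <= sqn A * sqn x.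
Proof.
rewrite [leLHS]sqnE [sqn A]sqnE mulr_suml; apply: ler_sum => i _.
rewrite big_ord1.
have -> : (A *m x) i 0 = frob (row i A)^T x.
  rewrite frobE mxE; apply: eq_bigr => j _.
  by rewrite big_ord1 !mxE.
apply: le_trans (frob_CauchySchwarz _ _) _.
rewrite ler_wpM2r ?sqn_ge0// sqnE exchange_big big_ord1.
by rewrite le_eqVlt; apply/orP; left; apply/eqP/eq_bigr => j _; rewrite !mxE.
Qed.

End Frobenius.

(** * Contractions, and a positivity criterion for determinants *)

Section Contraction.
Variables (R : realType).
Implicit Types (n : nat).

Lemma contractive_conv n (X Y : 'M[R]_n) t : contractive X -> contractive Y ->
  0 <= t <= 1 -> contractive (X + t *: (Y - X)).
Proof.
move=> cX cY t01 x /=; have := cX x; have := cY x.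
rewrite mulmxDl -scalemxAl mulmxBl.
set a := X *m x; set b := Y *m x => cb ca.
have -> : sqn (a + t *: (b - a)) =
    (1 - t) * sqn a + t * sqn b - t * (1 - t) * sqn (b - a).
  rewrite !(sqnD, sqnZ, sqnN, frobZr, frobBr, frobNr) -/(sqn a) (frobC b a).
  by ring.
have /andP[t0 t1] := t01; rewrite -subr_ge0 in t1.
have := ler_wpM2l t1 ca; have := ler_wpM2l t0 cb.
have := mulr_ge0 (mulr_ge0 t0 t1) (sqn_ge0 (b - a)); lra.
Qed.

(** With z = X^T y, one has |z|^2 = <y, X z>, which is at most (|y|^2 + |X z|^2) / 2, and |X z| <=
    |z|. *)
Lemma contractive_tr n (X : 'M[R]_n) : contractive X -> contractive X^T.
Proof.
move=> cX y /=; have := cX (X^T *m y).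
have := frob_le_sqn y (X *m (X^T *m y)).
have -> : frob y (X *m (X^T *m y)) = sqn (X^T *m y).
  by rewrite /sqn frob_mull trmxK.
lra.
Qed.

Lemma contractive_sqn_col n (X : 'M[R]_n) j : contractive X ->
  \sum_i X i j ^+ 2 <= 1.
Proof.
move=> /(_ (delta_mx j 0)); rewrite -colE !sqnE.
under eq_bigr do rewrite big_ord1 mxE.
under [leRHS]eq_bigr do rewrite big_ord1 mxE eqxx andbT.
move/le_trans; apply; rewrite (bigD1 j)//= eqxx expr1n big1 ?addr0//.
by move=> i /negPf->; rewrite expr0n.
Qed.

Lemma contractive_entry n (X : 'M[R]_n) i j : contractive X -> `|X i j| <= 1.
Proof.
move=> cX; rewrite -(ler_pXn2r (n := 2))// ?nnegrE//.
rewrite expr1n real_normK ?num_real//.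
apply: le_trans (contractive_sqn_col j cX); rewrite (bigD1 i)//= lerDl.
by apply: sumr_ge0 => k _; rewrite sqr_ge0.
Qed.

Lemma contractive_sqn n (X : 'M[R]_n) : contractive X -> sqn X <= n%:R.
Proof.
move=> cX; rewrite sqnE exchange_big.
apply: le_trans (ler_sum _ (fun j _ => contractive_sqn_col j cX)) _.
by rewrite sumr_const card_ord.
Qed.

Lemma orthogonal_contractive n (X : 'M[R]_n) : X^T *m X = 1%:M -> contractive X.
Proof.
by move=> XX x /=; rewrite {1}/sqn frob_mull mulmxA XX mul1mx.
Qed.

(** Let t tend to 0. This stands in for differentiation: first-order conditions arrive with an error
    of order t. *)
Lemma le0_of_le_small_mul (a b d : R) : 0 < d ->
  (forall t, 0 < t <= d -> a <= t * b) -> a <= 0.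
Proof.
move=> d0 h; rewrite leNgt; apply/negP => a0.
have b0 : 0 < b.
  have := h d; rewrite d0 lexx => /(_ isT) ad.
  by rewrite -(pmulr_rgt0 _ d0); apply: lt_le_trans ad.
pose t := Num.min d (a / (2 * b)).
have t0 : 0 < t by rewrite lt_min d0/= divr_gt0// mulr_gt0.
have := h t; rewrite t0 ge_min lexx => /(_ isT).
have : t <= a / (2 * b) by rewrite ge_min lexx orbT.
rewrite ler_pdivlMr ?mulr_gt0//; lra.
Qed.

(** [S] may be non-symmetric, so eigenvalues are avoided. On the segment from the identity to [S],
    the quadratic form is at least (1 - t) |v|^2, so the determinant cannot vanish for t < 1;
    starting from 1, it cannot become negative. *)
Lemma det_gt0_psd n (S : 'M[R]_n) :
  (forall x : 'cV_n, 0 <= frob x (S *m x)) -> \det S != 0 -> 0 < \det S.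
Proof.
move=> psd S0; rewrite lt_neqAle eq_sym S0/= leNgt; apply/negP => Sneg.
pose P : 'M[{poly R}]_n := map_mx polyC 1%:M + 'X *: map_mx polyC (S - 1%:M).
have PE t : (\det P).[t] = \det (1%:M + t *: (S - 1%:M)).
  rewrite -[LHS]/(horner_eval t _) -det_map_mx; congr (\det _).
  by apply/matrixP => i j; rewrite !mxE /= /horner_eval !hornerE mulrC.
(* The opposite polynomial goes from -1 at 0 to the value - det S > 0 at 1. *)
have [] := @poly_ivt R (- \det P) 0 1 ler01.
  rewrite !hornerE !PE scale0r addr0 det1 scale1r addrC subrK.
  by rewrite lerN10 /= oppr_ge0 ltW.
move=> t /andP[t_ge0 t_le1]; rewrite rootN rootE PE => /det0P[v v0 vS].
have t1 : t != 1.
  apply: contra_neq S0 => t1; apply/eqP/det0P; exists v => //.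
  by rewrite -vS t1 scale1r addrC subrK.
have {t1} tlt : 0 <= t < 1 by rewrite t_ge0 lt_neqAle t1.
have := psd v^T; have : 0 < sqn v^T.
  apply: sqn_gt0; apply: contra_neq v0 => /(congr1 trmx).
  by rewrite trmxK trmx0.
have : frob (v *m (1%:M + t *: (S - 1%:M))) v = 0.
  by rewrite vS /frob trmx0 mul0mx mxtrace0.
rewrite mulmxDr mulmx1 -scalemxAr mulmxBr mulmx1 frobDl frobZl frobDl.
rewrite -[- v]scaleN1r frobZl -[frob v v]frob_tr -/(sqn _) frob_mulr.
rewrite -[frob v _]frob_tr trmx_mul trmxK; nra.
Qed.

End Contraction.

(** * Maximizers of a linear functional over the contractions *)

Section Argmax.
Variables (R : realType) (n : nat).

Definition contractive_argmax (Y X : 'M[R]_n) :=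
  contractive X /\ forall Z, contractive Z -> frob Y Z <= frob Y X.

Lemma contractive_argmax_tr (Y X : 'M[R]_n) :
  contractive_argmax Y X -> contractive_argmax Y^T X^T.
Proof.
move=> [cX mX]; split=> [|Z cZ]; first exact: contractive_tr.
by rewrite -frob_tr trmxK !frob_tr; apply: mX; exact: contractive_tr.
Qed.

(** Moving along [N] leaves the contractions only to second order. Rescaling by 1 + c t^2 brings the
    point back at a cost of order t^2, which disappears after division by t as t tends to 0. *)
Lemma contractive_argmax_tangent (Y X N : 'M[R]_n) c d :
  contractive_argmax Y X -> 0 <= c -> 0 < d ->
  (forall t, 0 < t <= d -> forall x : 'cV_n,
    sqn ((X + t *: N) *m x) <= (1 + c * t ^+ 2) * sqn x) ->
  frob Y N <= 0.
Proof.
move=> [cX mX] c0 d0 small.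
apply: (@le0_of_le_small_mul _ _ (c * frob Y X) _ d0) => t /[dup] t0d /andP[t0 td].
have s1 : 1 <= 1 + c * t ^+ 2 by rewrite lerDl mulr_ge0// sqr_ge0.
have s0 : 0 < 1 + c * t ^+ 2 by apply: lt_le_trans s1.
set s := 1 + c * t ^+ 2 in s1 s0.
(* Dividing by [s] instead of its square root is enough, because s <= s^2 when s >= 1. *)
have cZ : contractive (s^-1 *: (X + t *: N)).
  move=> x /=; rewrite -scalemxAl sqnZ exprVn ler_pdivrMl ?exprn_gt0//.
  apply: le_trans (small t t0d x) _; rewrite ler_wpM2r ?sqn_ge0//.
  by rewrite expr2 ler_peMl// ltW.
have := mX _ cZ; rewrite frobZr ler_pdivrMl// frobDr frobZr /s => le1.
rewrite -(ler_pM2l t0); have -> : t * (t * (c * frob Y X)) =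
  (1 + c * t ^+ 2) * frob Y X - frob Y X by ring.
by rewrite lerBrDl.
Qed.

(** Move along X A, where A = S - S^T is skew and S = X^T Y: since <x, A x> = 0, the norm of x + t A
    x grows only to second order. Hence <S, A> <= 0, whereas |A|^2 = 2 <S, A>. *)
Lemma contractive_argmax_sym (Y X : 'M[R]_n) :
  contractive_argmax Y X -> X^T *m Y = Y^T *m X.
Proof.
move=> max; have [cX _] := max.
set S := X^T *m Y; have ST : Y^T *m X = S^T by rewrite /S trmx_mul trmxK.
pose A := S - S^T.
have AT : A^T = - A by rewrite /A linearB /= trmxK opprB.
have skew (x : 'cV_n) : frob x (A *m x) = 0.
  have : frob x (A *m x) = - frob x (A *m x).
    by rewrite {1}frobC frob_mull AT mulNmx frobNr.
  lra.
have : frob Y (X *m A) <= 0.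
  apply: (@contractive_argmax_tangent _ _ _ (sqn A) 1 max (sqn_ge0 _) ltr01).
  move=> t _ x.
  have -> : (X + t *: (X *m A)) *m x = X *m (x + t *: (A *m x)).
    by rewrite mulmxDr mulmxDl -scalemxAl -scalemxAr mulmxA.
  apply: le_trans (cX _) _; rewrite sqnD frobZr skew sqnZ.
  by have := ler_wpM2l (sqr_ge0 t) (sqn_mul_le A x); lra.
rewrite frobC frob_mull frobC -/S => SA.
have S_A : sqn A = 2 * frob S A.
  by rewrite /A sqnD sqnN frobBr frobNr /sqn frob_tr; ring.
have : A = 0 by apply: sqn_eq0; have := sqn_ge0 A; lra.
by rewrite ST => /subr0_eq.
Qed.

(* With [E = 1 - X^T X] and [F = 1 - X X^T], moving along [F F Y E E] stays in
   the contractives to first order, so that [F Y E = 0]; the symmetry of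
   [X^T Y] and [Y X^T] gives [F Y = Y E], hence [Y E E = 0]. *)
Lemma contractive_argmax_orthogonal (Y X : 'M[R]_n) :
  contractive_argmax Y X -> Y \in unitmx -> X^T *m X = 1%:M.
Proof.
move=> max Yu; have [cX _] := max.
have sym1 := contractive_argmax_sym max.
have sym2 := contractive_argmax_sym (contractive_argmax_tr max).
rewrite !trmxK in sym2.
pose E := 1%:M - X^T *m X; pose F := 1%:M - X *m X^T.
have ET : E^T = E by rewrite /E linearB /= trmx1 trmx_mul trmxK.
have FT : F^T = F by rewrite /F linearB /= trmx1 trmx_mul trmxK.
have XE : X *m E = F *m X.
  by rewrite mulmxBr mulmxBl mulmx1 mul1mx !mulmxA.
have EX : E *m X^T = X^T *m F.
  by rewrite mulmxBr mulmxBl mulmx1 mul1mx !mulmxA.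
have YE : F *m Y = Y *m E.
  by rewrite mulmxBr mulmxBl mulmx1 mul1mx -mulmxA sym1 !mulmxA -sym2.
pose G := F *m Y *m E.
have frobN (x : 'cV_n) :
    2 * frob (X *m x) (F *m G *m E *m x) <= (1 + sqn G) * sqn (E *m x).
  have -> : frob (X *m x) (F *m G *m E *m x) =
      frob (X *m (E *m x)) (G *m (E *m x)).
    by rewrite !frob_mull ET !mulmxA EX.
  apply: le_trans (frob_le_sqn _ _) _.
  by have := cX (E *m x); have := sqn_mul_le G (E *m x); rewrite /= !mulmxA; lra.
(* The slack |E x|^2 gained here absorbs the first-order term bounded in [frobN]. *)
have sqnX (x : 'cV_n) : sqn (X *m x) + sqn (E *m x) <= sqn x.
  have := contractive_tr cX (X *m x).
  have -> : E *m x = x - X^T *m (X *m x) by rewrite mulmxBl mul1mx mulmxA.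
  rewrite /= sqnD frobNr sqnN -frob_mull -/(sqn _); lra.
have : frob Y (F *m G *m E) <= 0.
  (* For t <= d the cross term is at most t (1 + |G|^2) |E x|^2 <= |E x|^2, which [sqnX] covers. *)
  pose d := (1 + sqn G)^-1.
  have G0 : 0 < 1 + sqn G by have := sqn_ge0 G; lra.
  have d0 : 0 < d by rewrite invr_gt0.
  apply: (@contractive_argmax_tangent _ _ _ (sqn (F *m G *m E)) d max _ d0).
    exact: sqn_ge0.
  move=> t /andP[t0 td] x; rewrite mulmxDl -scalemxAl sqnD frobZr sqnZ.
  have tG : t * (1 + sqn G) <= 1.
    by rewrite -(ler_pM2r G0) mulVf ?gt_eqF in td.
  have := ler_wpM2l (ltW t0) (frobN x).
  have := ler_wpM2r (sqn_ge0 (E *m x)) tG.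
  have := ler_wpM2l (sqr_ge0 t) (sqn_mul_le (F *m G *m E) x).
  have := sqnX x; lra.
have -> : frob Y (F *m G *m E) = sqn G.
  by rewrite [RHS](frob_mulr (F *m Y)) frob_mull FT ET mulmxA.
move=> G0; have {G0} : G = 0 by apply: sqn_eq0; have := sqn_ge0 G; lra.
rewrite /G YE -mulmxA => /(congr1 (mulmx (invmx Y))).
rewrite mulKmx// mulmx0 => EE.
have : E = 0 by apply: sqn_eq0; rewrite /sqn /frob ET EE mxtrace0.
by move/subr0_eq.
Qed.

(** Once X is orthogonal, only the sign of its determinant is open. X^T Y is positive semidefinite
    and invertible, as in a polar decomposition, so det X has the sign of det Y. *)
Lemma contractive_argmax_SO (Y X : 'M[R]_n) :
  contractive_argmax Y X -> 0 < \det Y -> SO X.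
Proof.
move=> max Y0; have Yu : Y \in unitmx by rewrite unitmxE unitfE gt_eqF.
have XX := contractive_argmax_orthogonal max Yu.
have [cX mX] := max; split=> //.
have detX : \det X ^+ 2 = 1.
  by rewrite expr2 -{1}det_tr -det_mulmx XX det1.
have X0 : \det X != 0 by apply/eqP => X0; move: detX; rewrite X0; lra.
suff : 0 < \det (X^T *m Y).
  rewrite det_mulmx det_tr pmulr_lgt0// => Xpos.
  by apply/eqP; rewrite -(eqrXn2 (n := 2))// ?ler01 ?ltW// expr1n detX.
apply: det_gt0_psd => [x|]; last by rewrite det_mulmx det_tr mulf_neq0 // gt_eqF.
have [->|x0] := eqVneq x 0; first by rewrite /frob mulmx0 mulmx0 mxtrace0.
have s0 := sqn_gt0 x0.
(* Compare [X] with its composition with the reflection in [x]. *)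
pose Z := X - (2 / sqn x) *: (X *m (x *m x^T)).
have cZ : contractive Z.
  move=> y; pose r : R := (x^T *m y) 0 0.
  have -> : Z *m y = X *m (y - (2 / sqn x * r) *: x).
    rewrite mulmxBr mulmxBl -scalemxAl -!mulmxA [x^T *m y]mx11_scalar -/r.
    by rewrite mul_mx_scalar -!scalemxAr scalerA.
  apply: le_trans (cX _) _; rewrite sqnD sqnN frobNr !frobZr sqnZ.
  have -> : frob y x = r by rewrite frobC /frob trace_mx11.
  suff -> : sqn y + 2 * - (2 / sqn x * r * r) + (2 / sqn x * r) ^+ 2 * sqn x =
    sqn y by [].
  by field; rewrite gt_eqF.
have := mX Z cZ; rewrite /Z frobBr frobZr lerBlDr lerDl pmulr_rge0 ?divr_gt0//.
by rewrite frobC mulmxA frob_mulr trmxK frob_mull mulmxA.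
Qed.

End Argmax.

(** * Continuity of matrix expressions and compactness of matrix sets *)

Section MatrixTopology.
Variable R : realType.

(** Working entry by entry reduces products and determinants to finite sums and products of real
    functions. *)
Definition entrywise_continuous (T : topologicalType) (m n : nat)
    (F : T -> 'M[R]_(m, n)) :=
  forall i j, continuous (fun t => F t i j).

Lemma continuous_bigsum (T : topologicalType) (I : Type) (r : seq I)
    (P : pred I) (f : I -> T -> R) :
  (forall i, P i -> continuous (f i)) ->
  continuous (fun t => \sum_(i <- r | P i) f i t).
Proof.
by move=> cf t; apply: cvg_big => [|i Pi]; [exact: add_continuous|exact: cf].
Qed.

Lemma continuous_bigprod (T : topologicalType) (I : Type) (r : seq I)
    (P : pred I) (f : I -> T -> R) :
  (forall i, P i -> continuous (f i)) ->
  continuous (fun t => \prod_(i <- r | P i) f i t).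
Proof.
by move=> cf t; apply: cvg_big => [|i Pi]; [exact: mul_continuous|exact: cf].
Qed.

Lemma continuous_mul (T : topologicalType) (f g : T -> R) :
  continuous f -> continuous g -> continuous (fun t => f t * g t).
Proof. by move=> cf cg t; exact: continuousM (cf t) (cg t). Qed.

Lemma continuous_sub (T : topologicalType) (f g : T -> R) :
  continuous f -> continuous g -> continuous (fun t => f t - g t).
Proof. by move=> cf cg t; exact: continuousB (cf t) (cg t). Qed.

Lemma entrywise_continuous_id m n :
  entrywise_continuous (fun X : 'M[R]_(m, n) => X).
Proof. by move=> i j; exact: coord_continuous. Qed.

Lemma entrywise_continuous_cst (T : topologicalType) m n (A : 'M[R]_(m, n)) :
  entrywise_continuous (fun _ : T => A).
Proof. by move=> i j; exact: cst_continuous. Qed.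

Lemma entrywise_continuous_tr (T : topologicalType) m n
    (F : T -> 'M[R]_(m, n)) :
  entrywise_continuous F -> entrywise_continuous (fun t => (F t)^T).
Proof.
by move=> cF i j; under [X in continuous X]eq_fun do rewrite mxE; exact: cF.
Qed.

Lemma entrywise_continuous_sub (T : topologicalType) m n
    (F G : T -> 'M[R]_(m, n)) :
  entrywise_continuous F -> entrywise_continuous G ->
  entrywise_continuous (fun t => F t - G t).
Proof.
move=> cF cG i j; under [X in continuous X]eq_fun do rewrite !mxE.
exact: continuous_sub.
Qed.

Lemma entrywise_continuous_mul (T : topologicalType) m n p
    (F : T -> 'M[R]_(m, n)) (G : T -> 'M[R]_(n, p)) :
  entrywise_continuous F -> entrywise_continuous G ->
  entrywise_continuous (fun t => F t *m G t).
Proof.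
move=> cF cG i j; under [X in continuous X]eq_fun do rewrite mxE.
by apply: continuous_bigsum => k _; exact: continuous_mul.
Qed.

Lemma continuous_det (T : topologicalType) n (F : T -> 'M[R]_n) :
  entrywise_continuous F -> continuous (fun t => \det (F t)).
Proof.
move=> cF; apply: continuous_bigsum => s _; apply: continuous_mul.
  exact: cst_continuous.
by apply: continuous_bigprod.
Qed.

Lemma continuous_frob (T : topologicalType) m n (F G : T -> 'M[R]_(m, n)) :
  entrywise_continuous F -> entrywise_continuous G ->
  continuous (fun t => frob (F t) (G t)).
Proof.
move=> cF cG; apply: continuous_bigsum => i _.
by apply: entrywise_continuous_mul => //; exact: entrywise_continuous_tr.
Qed.

Lemma vec_mx_continuous m n : continuous (@vec_mx R m n).
Proof.
move=> v A /nbhs_ballP[e e0 eA]; apply/nbhs_ballP; exists e => // w [_ vw].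
by apply: eA; split=> // i j; rewrite !mxE; exact: vw.
Qed.

(** Heine-Borel for matrices: the set is closed in the image under [vec_mx] of a compact box of row
    vectors. *)
Lemma closed_bounded_mx_compact m n (A : set 'M[R]_(m, n)) (b : R) :
  closed A -> (forall X, A X -> forall i j, `|X i j| <= b) -> compact A.
Proof.
move=> clA bA.
pose box := [set v : 'rV[R]_(m * n) | forall k, `[- b, b]%classic (v ord0 k)].
have cbox : compact box.
  by apply: (@rV_compact _ _ (fun=> `[- b, b]%classic)) => _; exact: segment_compact.
have cimg : compact (vec_mx @` box).
  apply: continuous_compact cbox.
  by apply: continuous_subspaceT; exact: vec_mx_continuous.
apply: subclosed_compact clA cimg _ => X AX.
exists (mxvec X); last by rewrite mxvecK.
move=> k; case/mxvec_indexP: k => i j.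
by rewrite mxvecE /= in_itv /= -ler_norml; exact: bA.
Qed.

Lemma closed_le_continuous (T : topologicalType) (f g : T -> R) :
  continuous f -> continuous g -> closed [set t | f t <= g t].
Proof.
move=> cf cg.
have -> : [set t | f t <= g t] = (fun t => f t - g t) @^-1` [set x | x <= 0].
  by apply/seteqP; split=> t /=; rewrite subr_le0.
by apply: preimage_closed; [move=> t _; exact: continuous_sub|exact: closed_le].
Qed.

Lemma closed_eq_continuous (T : topologicalType) (f g : T -> R) :
  continuous f -> continuous g -> closed [set t | f t = g t].
Proof.
move=> cf cg.
have -> : [set t | f t = g t] = [set t | f t <= g t] `&` [set t | g t <= f t].
  apply/seteqP; split=> t /= => [->|[fg gf]]; first by rewrite lexx.
  by apply/eqP; rewrite eq_le fg gf.
by apply: closedI; exact: closed_le_continuous.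
Qed.

Lemma compact_contractive n : compact (@contractive R n).
Proof.
apply: (@closed_bounded_mx_compact _ _ _ 1) => [|X cX i j]; last first.
  exact: contractive_entry.
have -> : @contractive R n =
    \bigcap_(x in [set: 'cV[R]_n]) [set X | sqn (X *m x) <= sqn x].
  by apply/seteqP; split=> X cX x; [move=> _|]; exact: cX.
apply: closed_bigI => x _; apply: closed_le_continuous; last exact: cst_continuous.
by apply: continuous_frob; apply: entrywise_continuous_mul;
  do ?[exact: entrywise_continuous_id | exact: entrywise_continuous_cst].
Qed.

Lemma SO_contractive n (X : 'M[R]_n) : SO X -> contractive X.
Proof. by move=> [XX _]; exact: orthogonal_contractive. Qed.

Lemma compact_SO n : compact (@SO R n).
Proof.
apply: subclosed_compact (@compact_contractive n) _; last exact: SO_contractive.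
have -> : @SO R n = (\bigcap_(ij in [set: 'I_n * 'I_n])
    [set X | (X^T *m X) ij.1 ij.2 = (1%:M : 'M_n) ij.1 ij.2]) `&`
    [set X | \det X = 1].
  apply/seteqP; split=> X [XX dX]; split=> //; first by move=> ij _ /=; rewrite XX.
  by apply/matrixP => i j; exact: (XX (i, j)).
apply: closedI; last first.
  apply: closed_eq_continuous; last exact: cst_continuous.
  exact/continuous_det/entrywise_continuous_id.
apply: closed_bigI => ij _; apply: closed_eq_continuous; last exact: cst_continuous.
apply: entrywise_continuous_mul; last exact: entrywise_continuous_id.
exact/entrywise_continuous_tr/entrywise_continuous_id.
Qed.

End MatrixTopology.

(** * Determinant of a weighted cyclic shift plus a diagonal *)

Section CyclicBidiagonal.
Variables (R : comNzRingType) (n : nat).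

(** A cyclic permutation matrix with one entry replaced by [c]; in size 1 it is just [c]. *)
Definition corner_shift (c : R) : 'M[R]_n.+1 :=
  \matrix_(i, j) ((j == i.+1 :> nat)%:R + c *+ ((i == ord_max) && (j == ord0))).

(** As the last diagonal entry is 0, the last row contains only the corner [c], and the
    complementary minor is lower triangular with unit diagonal. *)
Lemma det_corner_shift c (d : 'rV[R]_n.+1) : d 0 ord_max = 0 ->
  \det (corner_shift c + diag_mx d) = (-1) ^+ n * c.
Proof.
move=> dmax; set T := _ + _.
have diag0 (j : 'I_n.+1) : d 0 ord_max *+ (ord_max == j) = 0.
  by rewrite dmax mul0rn.
rewrite (expand_det_row _ ord_max) (bigD1 ord0)//= big1 ?addr0 => [|j j0]; last first.
  rewrite !mxE eqxx (negPf j0)/= mulr0n addr0 diag0 addr0.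
  by case: eqP => [jn|_]; [have := ltn_ord j; rewrite jn ltnn|rewrite mul0r].
have -> : T ord_max ord0 = c by rewrite !mxE !eqxx/= mulr1n add0r diag0 addr0.
suff -> : cofactor T ord_max ord0 = (-1) ^+ n by rewrite mulrC.
(* Deleting the first column shifts the ones onto the diagonal and the entries of [d] just below
   it. *)
have minorE (i j : 'I_n) : row' ord_max (col' ord0 T) i j =
    (j == i)%:R + d 0 (widen_ord (leqnSn n) i) *+ (i == j.+1 :> nat).
  rewrite !mxE [lift ord0 j == ord0]eq_sym (negPf (neq_lift _ _)) andbF mulr0n addr0.
  rewrite -!val_eqE /= !/bump !leq0n /= leqNgt ltn_ord add0n !add1n eqSS.
  by congr (_ + d _ _ *+ _); apply: val_inj; rewrite /= /bump leqNgt ltn_ord.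
rewrite /cofactor addn0 det_trig ?big1 ?mulr1// => [i _|].
  by rewrite minorE eqxx ltn_eqF// mulr0n addr0.
apply/is_trig_mxP => i j ij.
rewrite minorE -val_eqE /= (gtn_eqF ij) (@ltn_eqF i j.+1) ?mulr0n ?addr0//.
by rewrite ltnS ltnW.
Qed.
End CyclicBidiagonal.

(** * Rotations with prescribed diagonal entries of U^T X V *)

Section DiagonalFibre.
Variable R : realType.

Lemma frob_diag n (d : 'rV[R]_n) (A : 'M[R]_n) :
  frob (diag_mx d) A = \sum_i d 0 i * A i i.
Proof.
rewrite frobE; apply: eq_bigr => i _; rewrite (bigD1 i)//= big1 ?addr0.
  by rewrite mxE eqxx mulr1n.
by move=> j ji; rewrite mxE eq_sym (negPf ji) mulr0n mul0r.
Qed.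

Lemma continuous_sum_diag_sqr n (U V M : 'M[R]_n) (P : pred 'I_n) :
  continuous (fun X : 'M[R]_n =>
    \sum_(j | P j) ((U^T *m (X - M) *m V) j j) ^+ 2 : R).
Proof.
apply: continuous_bigsum => j _; apply: continuous_mul;
  apply: entrywise_continuous_mul; last 1 first.
all: do ?[exact: entrywise_continuous_cst | apply: entrywise_continuous_mul
  | apply: entrywise_continuous_sub | exact: entrywise_continuous_id].
Qed.

(* Maximize [<C, X>] minus a penalty for the constraints over the contractions.
   By the choice of [C], the gradient [Y] of the objective at the maximizer has
   a positive determinant, which does not depend on the maximizer. *)
Lemma SO_diag_approx n (U V M : 'M[R]_n.+1) (e : R) :
  U \in unitmx -> V \in unitmx -> contractive M -> 0 < e ->
  exists2 X, SO X &
    forall j, j != ord_max -> `|(U^T *m (X - M) *m V) j j| <= e.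
Proof.
move=> Uu Vu cM e0.
(* With this choice the determinant of [Y] below equals (det U det V)^2. *)
pose c := (-1) ^+ n * (\det U * \det V).
pose C := U *m corner_shift n c *m V^T.
(* [b] bounds <C, X - M> for all contractions X and M. Comparing the maximizer with [M] gives w Q <=
   b, and w = b / e^2 turns this into Q <= e^2. *)
pose b := sqn C + n.+1%:R.
have b0 : 0 < b by rewrite ltr_wpDl ?sqn_ge0// ltr0n.
pose w := b / e ^+ 2.
have w0 : 0 < w by rewrite divr_gt0// exprn_gt0.
pose q (D : 'M[R]_n.+1) j := (U^T *m D *m V) j j.
pose Q D := \sum_(j | j != ord_max) q D j ^+ 2.
pose G X := frob C X - w * Q (X - M).
have [||X] := @compact_EVT_max _ R G _ _ (@compact_contractive R n.+1).
- by exists M.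
- apply: continuous_subspaceT; apply: continuous_sub.
    apply: continuous_frob; first exact: entrywise_continuous_cst.
    exact: entrywise_continuous_id.
  apply: continuous_mul; first exact: cst_continuous.
  exact: continuous_sum_diag_sqr.
rewrite inE => cX maxX.
have {}maxX Z : contractive Z -> G Z <= G X by move=> cZ; apply: maxX; rewrite inE.
(* The derivative of the penalty in the diagonal coordinates; the last entry is 0 because that
   coordinate is not penalized. [Y] is then the gradient of [G] at [X]. *)
pose d : 'rV[R]_n.+1 :=
  \row_j (if j == ord_max then 0 else - 2 * w * q (X - M) j).
pose Y := U *m (corner_shift n c + diag_mx d) *m V^T.
have YE Z : frob Y Z = frob C Z
    - 2 * w * \sum_(j | j != ord_max) q (X - M) j * q Z j.
  rewrite /Y mulmxDr mulmxDl frobDl -/C; congr (_ + _).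
  rewrite frob_mulr frob_mull trmxK mulmxA frob_diag (bigD1 ord_max)//=.
  rewrite mxE eqxx mul0r add0r mulr_sumr -sumrN; apply: eq_bigr => j jmax.
  by rewrite mxE (negPf jmax) !mulNr mulrA.
have qD A B t j : q (A + t *: B) j = q A j + t * q B j.
  by rewrite /q mulmxDr mulmxDl -scalemxAr -scalemxAl !mxE.
(* Maximality of [G] along the segment from X to Z gives <Y, Z - X> <= t w Q(Z - X) for every t in
   (0, 1]. *)
have amax : contractive_argmax Y X.
  split=> // Z cZ; rewrite -subr_le0 -frobBr.
  apply: (@le0_of_le_small_mul _ _ (w * Q (Z - X)) 1) => // t /andP[t0 t1].
  have t01 : 0 <= t <= 1 by rewrite ltW.
  have := maxX _ (contractive_conv cX cZ t01).
  rewrite /G addrAC frobDr frobZr.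
  have -> : Q (X - M + t *: (Z - X)) = Q (X - M) +
      2 * t * (\sum_(j | j != ord_max) q (X - M) j * q (Z - X) j)
      + t ^+ 2 * Q (Z - X).
    rewrite /Q !mulr_sumr -!big_split /=; apply: eq_bigr => j _.
    by rewrite qD; ring.
  rewrite YE; set S := \sum_(j | _) _ => GZ.
  rewrite -(ler_pM2l t0); nra.
have detY : 0 < \det Y.
  rewrite /Y !det_mulmx det_tr det_corner_shift ?mxE ?eqxx// /c.
  have -> : \det U * ((-1) ^+ n * ((-1) ^+ n * (\det U * \det V))) * \det V =
      ((-1) ^+ n) ^+ 2 * (\det U ^+ 2 * \det V ^+ 2) by ring.
  rewrite sqrr_sign mul1r.
  move: Uu Vu; rewrite !unitmxE !unitfE => Uu Vu.
  by rewrite mulr_gt0 // exprn_even_gt0.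
exists X; first exact: contractive_argmax_SO amax detY.
move=> j jmax; rewrite -/(q _ j).
have QM : w * Q (X - M) <= b.
  have := maxX _ cM; rewrite /G subrr.
  have -> : Q 0 = 0.
    by rewrite /Q big1// => k _; rewrite /q mulmx0 mul0mx mxE expr0n.
  have := frob_le_sqn C X; have := frob_le_sqn C (- M).
  rewrite frobNr sqnN; have := contractive_sqn cX; have := contractive_sqn cM.
  rewrite /b; lra.
have Qe : Q (X - M) <= e ^+ 2.
  rewrite -(ler_pM2l w0); apply: le_trans QM _.
  by rewrite /w divfK// expf_neq0// gt_eqF.
rewrite -(ler_pXn2r (n := 2))// ?nnegrE ?(ltW e0)// real_normK ?num_real//.
apply: le_trans Qe; rewrite /Q (bigD1 j)//= lerDl.
by apply: sumr_ge0 => k _; rewrite sqr_ge0.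
Qed.

(** A shift by s fails only if s is a root of the characteristic polynomial of -U or -V. Their
    product [p] has fewer than [size p] roots, so one of the [size p] distinct values t / (i + 1)
    works. *)
Lemma unitmx_shift n (U V : 'M[R]_n) (t : R) : 0 < t ->
  exists2 s, 0 < s <= t & (U + s%:M \in unitmx) && (V + s%:M \in unitmx).
Proof.
move=> t0; pose p := char_poly (- U) * char_poly (- V).
have p0 : p != 0.
  by rewrite mulf_neq0// monic_neq0// char_poly_monic.
have rootP (A : 'M[R]_n) s : A + s%:M \notin unitmx -> root (char_poly (- A)) s.
  rewrite unitmxE unitfE negbK => /det0P[v v0 vA].
  rewrite -eigenvalue_root_char; apply/eigenvalueP; exists v => //.
  apply/eqP; rewrite -subr_eq0 mulmxN -opprD oppr_eq0 -mul_mx_scalar -mulmxDr.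
  by apply/eqP.
pose f (i : nat) : R := t / i.+1%:R.
have [/hasP[i _ nroot]|/hasPn allroot] :=
    boolP (has (fun i => ~~ root p (f i)) (iota 0 (size p))).
  exists (f i).
    by rewrite divr_gt0 ?ltr0n//= ler_pdivrMr ?ltr0n// ler_peMr ?ler1n// ltW.
  rewrite rootM negb_or in nroot; move/andP: nroot => [rU rV].
  by apply/andP; split; apply: contraNT (rootP _ _) _.
have finj : injective f.
  move=> i j /(mulfI (lt0r_neq0 t0))/invr_inj/eqP.
  by rewrite eqr_nat eqSS => /eqP.
have := @max_poly_roots _ p (map f (iota 0 (size p))) p0.
rewrite size_map size_iota ltnn map_inj_uniq// iota_uniq => /(_ _ isT) abs.
suff : false by [].
by apply: abs; rewrite all_map; apply/allP => i /allroot /=; rewrite negbK.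
Qed.

Lemma contractive_mul_entry n (A X M : 'M[R]_n) i j :
  contractive X -> contractive M ->
  `|(A *m (X - M)) i j| <= 2 * \sum_k `|A i k|.
Proof.
move=> cX cM; rewrite mxE mulr_sumr; apply: le_trans (ler_norm_sum _ _ _) _.
apply: ler_sum => k _; rewrite normrM mulrC ler_wpM2r// !mxE.
apply: le_trans (ler_normB _ _) _.
by have := contractive_entry k j cX; have := contractive_entry k j cM; lra.
Qed.

(** The residual attains its minimum on the compact set of rotations. Approximate solutions for
    small invertible shifts of U and V make it arbitrarily small, so the minimum is 0. *)
Lemma SO_diag_exact n (U V M : 'M[R]_n.+1) : contractive M ->
  exists2 X, SO X & forall j, j != ord_max -> (U^T *m (X - M) *m V) j j = 0.
Proof.
move=> cM.
pose Q X := \sum_(j | j != ord_max) ((U^T *m (X - M) *m V) j j) ^+ 2.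
have [||X] := @compact_EVT_min _ R Q _ _ (@compact_SO R n.+1).
- by exists 1%:M; split; rewrite ?det1// trmx1 mulmx1.
- by apply: continuous_subspaceT; exact: continuous_sum_diag_sqr.
rewrite inE => SOX minX; exists X => //.
suff Q0 : Q X <= 0.
  have /psumr_eq0P Q0j : Q X = 0.
    by apply/eqP; rewrite eq_le Q0 sumr_ge0// => j _; rewrite sqr_ge0.
  move=> j /(Q0j (fun _ _ => sqr_ge0 _)) /eqP.
  by rewrite sqrf_eq0 => /eqP.
(* Error per unit of s: 1 from the approximation, 2 from the entry of W, and the two sums from W V
   and U^T W. *)
pose a j := 3 + 2 * (\sum_k `|V^T j k|) + 2 * (\sum_k `|U^T j k|).
apply: (@le0_of_le_small_mul _ _ (\sum_(j | j != ord_max) a j ^+ 2) 1) => // t.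
move=> /andP[t0 t1].
have [s /andP[s0 st] /andP[Us Vs]] := unitmx_shift U V t0.
(* The same [s] serves as shift and as precision. Each squared residual is then at most s^2 (a j)^2
   <= t (a j)^2, as s <= t <= 1. *)
have [Z SOZ Zs] := SO_diag_approx Us Vs cM s0.
have cZ := SO_contractive SOZ.
apply: (@le_trans _ _ (Q Z)); first by apply: minX; rewrite inE.
rewrite mulr_sumr; apply: ler_sum => j jmax.
set W := Z - M.
have W2 : `|W j j| <= 2.
  rewrite !mxE; apply: le_trans (ler_normB _ _) _.
  by have := contractive_entry j j cZ; have := contractive_entry j j cM; lra.
have WV : `|(W *m V) j j| <= 2 * \sum_k `|V^T j k|.
  have := contractive_mul_entry V^T j j (contractive_tr cZ) (contractive_tr cM).
  by rewrite -linearB -trmx_mul mxE.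
have UW : `|(U^T *m W) j j| <= 2 * \sum_k `|U^T j k|.
  exact: contractive_mul_entry.
have := Zs j jmax; rewrite -/W.
have -> : (U + s%:M)^T *m W *m (V + s%:M) = U^T *m W *m V +
    s *: (W *m V + U^T *m W + s *: W).
  clearbody W; rewrite [(U + _)^T]linearD /= tr_scalar_mx mulmxDl mul_scalar_mx.
  rewrite mulmxDr !mulmxDl.
  rewrite !mul_mx_scalar -!scalemxAl !scalerDr.
  by rewrite !addrA.
set E := U^T *m W *m V => Es.
have Ea : `|E j j| <= s * a j.
  have -> : E j j = (E + s *: (W *m V + U^T *m W + s *: W)) j j -
     s * ((W *m V) j j + (U^T *m W) j j + s * W j j).
    clearbody E W; move: (W *m V) (U^T *m W) => P P1.
    by rewrite ![in RHS]mxE; ring.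
  apply: le_trans (ler_normB _ _) _.
  have -> : s * a j =
      s + s * (2 * (\sum_k `|V^T j k|) + 2 * (\sum_k `|U^T j k|) + 2).
    by rewrite /a; ring.
  apply: lerD => //; rewrite normrM gtr0_norm// ler_pM2l//.
  apply: le_trans (ler_normD _ _) _; apply: lerD.
    by apply: le_trans (ler_normD _ _) _; exact: lerD.
  rewrite normrM gtr0_norm//; have := normr_ge0 (W j j); nra.
have := ler_pXn2r (n := 2) isT (normr_ge0 (E j j)).
move=> /(_ (s * a j)); rewrite nnegrE (le_trans _ Ea)// => /(_ isT).
rewrite Ea real_normK ?num_real// exprMn => Ea2.
apply: le_trans Ea2 _; rewrite ler_wpM2r ?sqr_ge0//.
nra.
Qed.

End DiagonalFibre.

(** * Rank-one functionals and convexity of the image *)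

Lemma mxinner_rank1 (R : realType) n (u v : 'cV[R]_n) (X : 'M[R]_n) :
  mxinner (u *m v^T) X = frob u (X *m v).
Proof. by rewrite -[LHS]/(frob _ _) frob_mulr trmxK. Qed.

Lemma frob_col (R : realType) n (U V X : 'M[R]_n) i j :
  frob (col i U) (X *m col j V) = (U^T *m X *m V) i j.
Proof.
rewrite /frob trace_mx11 tr_col mulmxA -row_mul !mxE.
by apply: eq_bigr => l _; rewrite !mxE.
Qed.

Theorem proposition3 (R : realType) (n k m : nat) (hk : (k < n)%N)
    (u v : 'I_k -> 'cV[R]_n) (beta : 'I_m -> 'I_k -> R)
    (B : 'I_m -> 'M[R]_n)
    (hB : forall i : 'I_m, B i = \sum_(j < k) beta i j *: (u j *m (v j)^T)) :
  convex_set (mxinner_map B @` @SO R n).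
Proof.
case: n => [//|n] in hk u v B hB *.
move=> x y t; rewrite !inE => -[X SOX <-] [Y SOY <-].
(* The k vectors become the first columns; [insub] fails from index k on, and those columns are
   0. *)
pose ext (a : 'I_k -> 'cV[R]_n.+1) : 'M[R]_n.+1 :=
  \matrix_(i, j) oapp (fun l => a l i 0) 0 (insub (j : nat)).
have col_ext a (j : 'I_k) : col (widen_ord (ltnW hk) j) (ext a) = a j.
  by apply/colP => i; rewrite !mxE /= valK.
(* The convex combination gives weight t to its first point, so [Y] receives 1 - t. *)
pose M := X + (1 - t%:num) *: (Y - X).
have t01 : 0 <= 1 - t%:num <= 1.
  by rewrite subr_ge0 gerBl le1 ge0.
have cM : contractive M.
  by apply: contractive_conv t01; exact: SO_contractive.
have [Z SOZ ZM] := SO_diag_exact (ext u) (ext v) cM.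
exists Z => //; apply/rowP => i.
have innerE W : mxinner (B i) W = \sum_(j < k) beta i j * frob (u j) (W *m v j).
  rewrite hB -[LHS]/(frob _ _) frob_suml; apply: eq_bigr => j _.
  by rewrite frobZl -[frob _ _]/(mxinner _ _) mxinner_rank1.
(* As k is at most the index of the last column, the one uncontrolled diagonal entry never belongs
   to a given pair of vectors. *)
have ZM0 (j : 'I_k) : frob (u j) (Z *m v j) = frob (u j) (M *m v j).
  apply/eqP; rewrite -subr_eq0 -frobBr -mulmxBl -!col_ext frob_col ZM//.
  by rewrite -val_eqE /= ltn_eqF// (leq_trans (ltn_ord j)).
rewrite -[RHS]/((t%:num *: mxinner_map B X +
  (1 - t%:num) *: mxinner_map B Y) 0 i).
rewrite !mxE !innerE !mulr_sumr -big_split; apply: eq_bigr => j _ /=.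
rewrite ZM0 /M mulmxDl frobDr -scalemxAl frobZr mulmxBl frobBr; ring.
Qed.
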